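(* Let $d\ge2$, $N\ge 1$, and let $(u,v)=(u_{(n)},v_{(n)})_{1\le n\le N}\in(\mathbb{R}^d\times\mathbb{R}^d)^N$ satisfy $$\langle u\rangle_N=\langle v\rangle_N=0,\qquad \langle|u|^2\rangle_N=\langle|v|^2\rangle_N=1.$$ Let $\alpha>0$ and $p_1,p_2>1$ with $\frac1{p_1}+\frac1{p_2}=1$. Then $$f\big(\langle|u-v|^2\rangle_N\big)\le k_\alpha\,\min\big(\kappa_{\langle u\otimes u\rangle_N},\kappa_{\langle v\otimes v\rangle_N}\big)\,m_{u,p_1(2+\alpha)}^{\frac{2+\alpha}{1+\alpha}}\,m_{v,p_2(2+\alpha)}^{\frac{2+\alpha}{1+\alpha}}\;\Big\langle|u-u_\ast||v-v_\ast|-(u-u_\ast)\cdot(v-v_\ast)\Big\rangle_N^{\frac{\alpha}{1+\alpha}},$$ where $k_\alpha=(1+\alpha)\left(\frac{2}{2+\alpha}\right)^{\frac{2+\alpha}{1+\alpha}}$.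
   Context: Averages over particles: $\langle o(u,v)\rangle_N=\frac1N\sum_{n=1}^N o(u_{(n)},v_{(n)})$, and for two-body quantities $\langle o(u,v,u_\ast,v_\ast)\rangle_N=\frac1{N^2}\sum_{n_1,n_2=1}^N o(u_{(n_1)},v_{(n_1)},u_{(n_2)},v_{(n_2)})$. For $x\in(\mathbb{R}^d)^N$ and $p\geq 1$, $m_{x,p}=\langle|x-x_\ast|^p\rangle_N^{1/p}$. $f(x)=x-\frac{x^2}4$ on $[0,4]$. For a symmetric non-negative $d\times d$ matrix $S$ of trace $1$ with largest eigenvalue $\|S\|$, $\kappa_S=(1-\|S\|)^{-1}\in[\frac d{d-1},+\infty]$ ($+\infty$ if $\|S\|=1$). If both condition numbers are $+\infty$ the right-hand side is read as $+\infty$. *)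

(* Defs.v *)
From HB Require Import structures.
From mathcomp Require Import all_boot all_order all_algebra.
From mathcomp Require Import all_classical all_reals all_analysis.
Import Order.TTheory GRing.Theory Num.Theory.
Import numFieldNormedType.Exports.
Set Implicit Arguments.
Unset Strict Implicit.
Unset Printing Implicit Defensive.
Local Open Scope classical_set_scope.
Local Open Scope ring_scope.

(* The values may be scalars, vectors or matrices, hence the codomain E. *)
Definition avg (R : realType) (E : lmodType R) (N : nat) (o : 'I_N -> E) : E :=
  N%:R^-1 *: \sum_(n < N) o n.

Definition avg2 (R : realType) (E : lmodType R) (N : nat)
    (o : 'I_N -> 'I_N -> E) : E :=
  (N%:R ^+ 2)^-1 *: \sum_(n1 < N) \sum_(n2 < N) o n1 n2.

Definition dotp (R : realType) (d : nat) (x y : 'cV[R]_d) : R :=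
  \sum_(i < d) x i 0 * y i 0.

(* The Euclidean norm: the norm `|x| that MathComp-Analysis puts on matrices
   is the maximum norm. *)
Definition enorm (R : realType) (d : nat) (x : 'cV[R]_d) : R :=
  Num.sqrt (dotp x x).

Definition otimes (R : realType) (d : nat) (x y : 'cV[R]_d) : 'M[R]_d :=
  x *m y^T.

Definition moment (R : realType) (d N : nat) (x : 'I_N -> 'cV[R]_d) (p : R) : R :=
  (avg2 (fun n m => enorm (x n - x m) `^ p)) `^ p^-1.

(* For d >= 1 and S symmetric, the set of eigenvalues is finite and nonempty,
   so that this supremum is attained. *)
Definition max_eigenvalue (R : realType) (d : nat) (S : 'M[R]_d) : R :=
  sup [set a : R | eigenvalue S a].

(* The case distinction is needed because 0^-1 = 0 in R. *)
Definition kappa (R : realType) (d : nat) (S : 'M[R]_d) : \bar R :=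
  if max_eigenvalue S == 1 then +oo%E else ((1 - max_eigenvalue S)^-1)%:E.

(* Only used on [0, 4]. *)
Definition f4 (R : realType) (x : R) : R := x - x ^+ 2 / 4.

Definition k_ (R : realType) (alpha : R) : R :=
  (1 + alpha) * (2 / (2 + alpha)) `^ ((2 + alpha) / (1 + alpha)).

(* Main.v *)
Require Import Defs.
From HB Require Import structures.
From mathcomp Require Import all_boot all_order all_algebra.
From mathcomp Require Import all_classical all_reals all_analysis.
From mathcomp Require Import ring lra.
From mathcomp Require Import complex.
Import Order.TTheory GRing.Theory Num.Theory.
Import numFieldNormedType.Exports.
Local Open Scope ring_scope.

(** Write U = u - u', V = v - v' for the differences of two particles and c for the
    average of u . v. The normalization gives |u - v|^2 the average 2 - 2 c, so the
    left-hand side is 1 - c^2. Both sides are compared with the average T of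
    |U|^2 |V|^2 - (U . V)^2, the squared sine of the angle between U and V weighted
    by lengths.

    Upper bound for T (two_body_deficit_le). With r = |U| |V| and A = r - U . V the
    integrand is A (2 r - A), and a one-variable maximization (deficit_le) bounds it
    by k_alpha r^((2 + alpha)/(1 + alpha)) A^(alpha/(1 + alpha)). The Hoelder
    inequality then produces the moments and the average of A (hoelder_moments).

    Lower bound for T (two_body_deficit_ge): (1 - lambda) (1 - c^2) <= T, where lambda
    is the largest eigenvalue of the average of u (x) u; by symmetry the same holds
    for v, and dividing by 1 - lambda gives the condition numbers. After a rotation
    the average of u (x) u is diagonal, and Lagrange's identity writes T as half the
    sum of the averages of the squared minors (U_i V_j - U_j V_i)^2. Expanding with
    centred u and v, such an average is at least 2 (a_i b_j + a_j b_i - 2 c_i c_j)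
    for i != j, where a_i, b_i, c_i are the averages of u_i^2, v_i^2, u_i v_i
    (two_body_minor_ge). What remains is an inequality between numbers with
    c_i^2 <= a_i b_i, sum a_i = sum b_i = 1 and a_i <= lambda (weighted_trace_le). *)

(** * Real symmetric matrices have orthonormal eigenbases *)

Lemma row_sqr_gt0 (R : realDomainType) (n : nat) (x : 'rV[R]_n) :
  x != 0 -> 0 < (x *m x^T) 0 0.
Proof.
have sqr_ge0' i : true -> 0 <= x 0 i * x^T i 0.
  by rewrite mxE -expr2 sqr_ge0.
move=> x0; rewrite mxE lt_def sumr_ge0// andbT.
apply: contra_neq x0 => xx0; apply/rowP => i.
have /eqP := psumr_eq0P sqr_ge0' xx0 (i := i) isT.
by rewrite !mxE -expr2 sqrf_eq0 => /eqP.
Qed.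

(** For an eigenvector z and its conjugate w, the number z S w^T equals both
    a |z|^2 and a^* |z|^2, because S is real and symmetric. *)
Lemma symmetric_complex_eigenvalue_real (R : rcfType) (n : nat) (S : 'M[R]_n)
    (z : 'rV[R[i]]_n) (a : R[i]) :
  S^T = S -> z != 0 -> z *m map_mx (real_complex R) S = a *: z ->
  a \is Num.real.
Proof.
move=> Ssym z0 zS.
set SC := map_mx _ S in zS.
set w := map_mx Num.conj z.
have wS : SC *m w^T = a^* *: w^T.
  have -> : SC = SC^T by rewrite map_trmx Ssym.
  rewrite -trmx_mul -linearZ/=; congr (_^T).
  have -> : SC = map_mx Num.conj SC.
    by apply/matrixP => i j; rewrite !mxE conj_Creal// complex_real.
  by rewrite -map_mxM zS map_mxZ.
have zw : (z *m w^T) 0 0 != 0.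
  apply: contra_neq z0 => zw0; apply/rowP => i; rewrite mxE.
  move: zw0; rewrite mxE.
  under eq_bigr do rewrite !mxE -normCK.
  move/eqP; rewrite psumr_eq0 => [/allP/(_ i)|j _]; last exact: exprn_ge0.
  by rewrite mem_index_enum => /(_ isT); rewrite sqrf_eq0 normr_eq0 => /eqP.
apply/CrealP; apply: (mulIf zw).
have : (z *m SC *m w^T) = z *m (SC *m w^T) by rewrite mulmxA.
rewrite zS wS -scalemxAl -scalemxAr => /matrixP/(_ 0 0).
by rewrite !mxE => ->.
Qed.

(** The matrix M represents S on the row space of B; it need not be symmetric,
    but a complex eigenvector of M yields one of S, so that the complex
    eigenvalues of M are real. This provides an eigenvector of S in a stable
    subspace without an orthonormal basis of that subspace. *)
Lemma stable_eigenvector (R : rcfType) (m n : nat) (S : 'M[R]_n)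
    (B : 'M[R]_(m, n)) (M : 'M[R]_m) :
  S^T = S -> (0 < m)%N -> row_free B -> B *m S = M *m B ->
  exists x : 'rV[R]_n, exists a : R,
    [/\ x != 0, (x <= B)%MS & x *m S = a *: x].
Proof.
move=> Ssym m_gt0 freeB BS.
have [aC aCM] := eigenvalue_closed (map_mx (real_complex R) M) m_gt0.
have /eigenvalueP[y yM y0] := aCM.
pose iB := map_mx (real_complex R) B.
have aCreal : aC \is Num.real.
  apply: (@symmetric_complex_eigenvalue_real R n S (y *m iB)) => //.
    apply: contra_neq y0 => yB; apply: (row_free_inj (A := iB)).
      by rewrite row_free_map.
    by rewrite yB mul0mx.
  by rewrite -mulmxA -map_mxM BS map_mxM mulmxA yM scalemxAl.
have [a aE] : exists a : R, aC = real_complex R a.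
  exact/complex_realP.
have : eigenvalue M a.
  move: aCM; rewrite !eigenvalue_root_char aE -map_char_poly.
  by rewrite fmorph_root.
move=> /eigenvalueP[x xM x0].
exists (x *m B), a; split.
- apply: contra_neq x0 => xB; apply: (row_free_inj freeB).
  by rewrite xB mul0mx.
- exact: submxMl.
- by rewrite -mulmxA BS mulmxA xM scalemxAl.
Qed.

(** The orthogonal complement K of the first k eigenvectors is stable under S,
    hence contains a further eigenvector, which is then normalized. *)
Lemma orthonormal_eigenfamily (R : rcfType) (n : nat) (S : 'M[R]_n) (k : nat) :
  S^T = S -> (k <= n)%N -> exists E : 'M[R]_(k, n), exists D : 'rV[R]_k,
    E *m E^T = 1%:M /\ E *m S = diag_mx D *m E.
Proof.
move=> Ssym; elim: k => [_|k IHk kn].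
  by exists 0, 0; split; apply/matrixP => -[].
have [E [D [EE ES]]] := IHk (ltnW kn).
pose K := kermx E^T.
have rankE : \rank E^T = k.
  rewrite mxrank_tr; apply/eqP; rewrite eqn_leq rank_leq_row /=.
  by rewrite -[X in (X <= _)%N](mxrank1 R) -EE mxrankM_maxl.
have rankK : (0 < \rank K)%N by rewrite mxrank_ker rankE subn_gt0.
have KS : stablemx K S.
  rewrite sub_kermx -mulmxA.
  have -> : S *m E^T = E^T *m diag_mx D.
    by rewrite -{1}Ssym -trmx_mul ES trmx_mul tr_diag_mx.
  by rewrite mulmxA mulmx_ker mul0mx.
have /submxP[M BS] : (row_base K *m S <= row_base K)%MS.
  by rewrite eq_row_base (eqmxMr S (eq_row_base K)).
have [x [a [x0 xB xS]]] :=
  @stable_eigenvector R _ n S (row_base K) M Ssym rankK (row_base_free K) BS.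
have xE : x *m E^T = 0.
  by apply/sub_kermxP; rewrite (submx_trans xB)// eq_row_base.
pose s := (x *m x^T) 0 0.
have s_gt0 : 0 < s by exact: row_sqr_gt0.
pose y := (Num.sqrt s)^-1 *: x.
have yy : y *m y^T = 1%:M.
  rewrite /y linearZ/= -scalemxAr -scalemxAl scalerA.
  rewrite [x *m _]mx11_scalar -/s -scalemx1 scalerA -invfM -expr2 sqr_sqrtr ?ltW//.
  by rewrite mulVf ?scale1r// gt_eqF.
have yE : y *m E^T = 0 by rewrite -scalemxAl xE scaler0.
have Ey : E *m y^T = 0 by rewrite -[LHS]trmxK trmx_mul trmxK yE trmx0.
rewrite -addn1.
exists (col_mx E y), (row_mx D a%:M); split.
  by rewrite tr_col_mx mul_col_row EE Ey yE yy -scalar_mx_block.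
rewrite mul_col_mx ES /y -scalemxAl xS diag_mx_row mul_block_col !mul0mx addr0 add0r.
congr col_mx.
rewrite scalerA mulrC -scalerA -mul_scalar_mx; congr (_ *m _).
by apply/matrixP => i j; rewrite !mxE !ord1 eqxx.
Qed.

(** * A trace inequality for diagonal entries *)

Lemma amgm_sqr (R : realFieldType) (p q s : R) :
  0 <= p -> 0 <= q -> s ^+ 2 <= p * q -> 2 * s <= p + q.
Proof.
move=> p0 q0 spq; rewrite leNgt; apply/negP => lt.
have := sqr_ge0 (p - q); nra.
Qed.

Lemma amgm_sqrM (R : realFieldType) (a b c a' b' c' : R) :
  0 <= a -> 0 <= b -> 0 <= a' -> 0 <= b' ->
  c ^+ 2 <= a * b -> c' ^+ 2 <= a' * b' ->
  2 * (c * c') <= a * b' + b * a'.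
Proof.
move=> a0 b0 a'0 b'0 cab cab'.
apply: amgm_sqr; rewrite ?mulr_ge0//.
by rewrite exprMn [leRHS](_ : _ = (a * b) * (a' * b')); [apply: ler_pM; rewrite ?sqr_ge0|ring].
Qed.

(** The Cauchy-Schwarz inequality, in the form where c i ^+ 2 is only bounded by
    the product of the weights. *)
Lemma sqr_sum_le (R : realFieldType) (I : finType) (P : pred I) (a b c : I -> R) :
  (forall i, 0 <= a i) -> (forall i, 0 <= b i) ->
  (forall i, c i ^+ 2 <= a i * b i) ->
  (\sum_(i | P i) c i) ^+ 2 <= (\sum_(i | P i) a i) * (\sum_(i | P i) b i).
Proof.
move=> a0 b0 cab.
suff [_ _] : [/\ 0 <= \sum_(i | P i) a i, 0 <= \sum_(i | P i) b i &
  (\sum_(i | P i) c i) ^+ 2 <= (\sum_(i | P i) a i) * (\sum_(i | P i) b i)] by [].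
apply: (big_rec3 (fun x y z => [/\ 0 <= x, 0 <= y & z ^+ 2 <= x * y])).
  by rewrite expr0n mulr0.
move=> i x y z _ [x0 y0 zxy]; split; rewrite ?addr_ge0//.
have := @amgm_sqrM R _ _ _ _ _ _ (a0 i) (b0 i) x0 y0 (cab i) zxy.
have := cab i; move: zxy; lra.
Qed.

(** The numbers a, b and c stand for the diagonals of the covariance matrices
    of (u, u), (v, v) and (u, v) in an eigenbasis of the first one. Write x i j
    for the summand on the right, P for the right-hand side and D for the sum
    of the x i i. Since a and b sum to 1, twice the second factor on the left is
    P + D. Multiplied by a i, the sum of the off-diagonal entries in row i of x is
    at least (1 - a i) (a i b i - c i ^+ 2). Summing over i and using
    a i + a j <= 1 for i != j gives (1 - L) D <= P, while (1 - L) P <= P because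
    L is nonnegative. *)
Lemma weighted_trace_le (R : realFieldType) (I : finType) (a b c : I -> R) (L : R) :
  (forall i, 0 <= a i) -> (forall i, 0 <= b i) ->
  (forall i, c i ^+ 2 <= a i * b i) ->
  \sum_i a i = 1 -> \sum_i b i = 1 -> (forall i, a i <= L) ->
  (1 - L) * (1 - (\sum_i c i) ^+ 2) <=
  \sum_i \sum_(j | j != i) (a i * b j + b i * a j - 2 * (c i * c j)).
Proof.
move=> a0 b0 cab a1 b1 aL.
pose x i j := a i * b j + b i * a j - 2 * (c i * c j).
have x0 i j : 0 <= x i j by rewrite subr_ge0 amgm_sqrM.
have xC i j : x i j = x j i by rewrite /x; ring.
(* An empty index type is excluded by the sum of the weights, so that L >= a i >= 0
   for some i. *)
have [i0 _|I0] := pickP (@predT I); last first.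
  by move: a1; rewrite big_pred0// => /esym/eqP; rewrite oner_eq0.
have L0 : 0 <= L by exact: le_trans (aL i0).
have compl (f : I -> R) i : \sum_j f j = f i + \sum_(j | j != i) f j.
  by rewrite (bigD1 i).
have row i : \sum_(j | j != i) x i j =
    a i * (1 - b i) + b i * (1 - a i) - 2 * (c i * \sum_(j | j != i) c j).
  rewrite /x sumrB big_split/= -!mulr_sumr; congr (_ * _ + _ * _ - _).
  - by rewrite -b1 (compl b i); ring.
  - by rewrite -a1 (compl a i); ring.
have main i : (1 - L) * (a i * b i - c i ^+ 2) <= a i * \sum_(j | j != i) x i j.
  apply: (@le_trans _ _ ((1 - a i) * (a i * b i - c i ^+ 2))).
    by apply: ler_wpM2r; [rewrite subr_ge0|rewrite lerD2l lerN2].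
  have a1i : 1 - a i = \sum_(j | j != i) a j by rewrite -a1 (compl a i); ring.
  have b1i : 1 - b i = \sum_(j | j != i) b j by rewrite -b1 (compl b i); ring.
  have ecs : (\sum_(j | j != i) c j) ^+ 2 <= (1 - a i) * (1 - b i).
    by rewrite a1i b1i sqr_sum_le.
  have a1_ge0 : 0 <= 1 - a i by rewrite a1i sumr_ge0.
  have b1_ge0 : 0 <= 1 - b i by rewrite b1i sumr_ge0.
  (* The claim is the weighted mean inequality
     2 a c e <= a^2 (1 - b) + c^2 (1 - a), where e^2 <= (1 - a) (1 - b). *)
  rewrite row; set e := \sum_(j | j != i) c j in ecs *.
  have : 2 * (a i * c i * e) <= a i ^+ 2 * (1 - b i) + c i ^+ 2 * (1 - a i).
    apply: amgm_sqr.
    - exact: mulr_ge0 (sqr_ge0 _) b1_ge0.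
    - exact: mulr_ge0 (sqr_ge0 _) a1_ge0.
    rewrite exprMn exprMn [leRHS](_ : _ = a i ^+ 2 * c i ^+ 2 * ((1 - a i) * (1 - b i))).
      by apply: ler_wpM2l => //; rewrite mulr_ge0 ?sqr_ge0.
    by ring.
  by lra.
pose P := \sum_i \sum_(j | j != i) x i j.
(* Symmetrizing turns the weight 2 a i into a i + a j, which is at most 1. *)
have half : 2 * \sum_i a i * \sum_(j | j != i) x i j <= P.
  have -> : 2 * \sum_i a i * \sum_(j | j != i) x i j =
      \sum_i \sum_(j | j != i) (a i + a j) * x i j.
    rewrite mulr_natl mulr2n.
    under [RHS]eq_bigr do under eq_bigr do rewrite mulrDl.
    under [RHS]eq_bigr do rewrite big_split/=.
    rewrite big_split/=; congr (_ + _).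
      by apply: eq_bigr => i _; rewrite mulr_sumr.
    rewrite (exchange_big_dep predT)//=; apply: eq_bigr => i _.
    rewrite mulr_sumr; apply: eq_big => j; first by rewrite eq_sym.
    by rewrite xC.
  apply: ler_sum => i _; apply: ler_sum => j ij.
  rewrite -[leRHS]mul1r; apply: ler_wpM2r => //.
  by rewrite -a1 (compl a i) lerD2l (bigD1 j)//= lerDl sumr_ge0.
have P_ge0 : 0 <= P by apply: sumr_ge0 => i _; apply: sumr_ge0.
have split2 : 2 * (1 - (\sum_i c i) ^+ 2) = P + 2 * \sum_i (a i * b i - c i ^+ 2).
  have -> : 2 * \sum_i (a i * b i - c i ^+ 2) = \sum_i x i i.
    by rewrite mulr_sumr; apply: eq_bigr => i _; rewrite /x; ring.
  rewrite /P -big_split/=.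
  under [RHS]eq_bigr => i _ do rewrite addrC -(compl (x i)).
  under [RHS]eq_bigr => i _ do
    rewrite /x sumrB big_split/= -!mulr_sumr a1 b1 !mulr1.
  by rewrite sumrB big_split/= a1 b1 -mulr_sumr -mulr_suml; ring.
have sum_main : (1 - L) * \sum_i (a i * b i - c i ^+ 2) <=
    \sum_i a i * \sum_(j | j != i) x i j.
  by rewrite mulr_sumr; apply: ler_sum => i _; exact: main.
rewrite -/P.
have LP : 0 <= L * P by rewrite mulr_ge0.
move: half sum_main split2 LP.
set D := \sum_i (_ - _); set Q := \sum_i a i * _ ; set C := _ ^+ 2.
move=> h1 h2 h3 h4.
have -> : 1 - C = (P + 2 * D) / 2 by lra.
lra.
Qed.

(** * Averages and their Hoelder inequalities *)

(** Young's inequality for x / F^(1/p) and y / G^(1/q). With F and G the averages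
    of the p-th and q-th powers, averaging both sides gives the Hoelder
    inequality. *)
Lemma young_normalized (R : realType) (p q x y F G : R) :
  0 < p -> 0 < q -> p^-1 + q^-1 = 1 -> 0 <= x -> 0 <= y -> 0 < F -> 0 < G ->
  x * y <= F `^ p^-1 * G `^ q^-1 *
    ((p * F)^-1 * x `^ p + (q * G)^-1 * y `^ q).
Proof.
move=> p0 q0 pq x0 y0 F0 G0.
have normalize (z C r : R) : 0 <= z -> 0 < C -> 0 < r ->
    (z / C `^ r^-1) `^ r / r = (r * C)^-1 * z `^ r.
  move=> z0 C0 r0; have Cr0 : 0 <= C `^ r^-1 by exact: powR_ge0.
  have -> : (z / C `^ r^-1) `^ r = z `^ r * C^-1.
    rewrite powRM ?invr_ge0// -powR_inv1// -!powRrM -(powR_inv1 (ltW C0)).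
    by rewrite mulrCA mulVf ?gt_eqF// mulr1.
  by field; rewrite !gt_eqF.
have A0 := powR_gt0 p^-1 F0; have B0 := powR_gt0 q^-1 G0.
have := conjugate_powR
  (divr_ge0 x0 (ltW A0)) (divr_ge0 y0 (ltW B0)) p0 q0 pq.
rewrite (normalize _ _ _ x0 F0 p0) (normalize _ _ _ y0 G0 q0).
by rewrite mulrACA -invfM ler_pdivrMr ?mulr_gt0// [leRHS]mulrC.
Qed.

Section Averages.
Variables (R : realType) (N : nat).
Implicit Types (o f g : 'I_N -> 'I_N -> R) (F G : 'I_N -> R).

Lemma avgE F : avg F = N%:R^-1 * \sum_n F n.
Proof. by []. Qed.

Lemma avgD F G : avg (fun n => F n + G n) = avg F + avg G.
Proof. by rewrite !avgE big_split mulrDr. Qed.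

Lemma avgZ (k : R) F : avg (fun n => k * F n) = k * avg F.
Proof. by rewrite !avgE -mulr_sumr mulrCA. Qed.

Lemma avgB F G : avg (fun n => F n - G n) = avg F - avg G.
Proof. by rewrite !avgE sumrB mulrBr. Qed.

Lemma avg_sum (I : finType) (F : I -> 'I_N -> R) :
  avg (fun n => \sum_i F i n) = \sum_i avg (F i).
Proof. by rewrite avgE exchange_big mulr_sumr. Qed.

Lemma avg_ge0 F : (forall n, 0 <= F n) -> 0 <= avg F.
Proof. by move=> F0; rewrite avgE mulr_ge0 ?invr_ge0// sumr_ge0. Qed.

Lemma avg_coord (d : nat) (x : 'I_N -> 'cV[R]_d) i :
  avg x i 0 = avg (fun n => x n i 0).
Proof. by rewrite mxE summxE. Qed.

Lemma avg2_avg o : avg2 o = avg (fun n => avg (o n)).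
Proof. by rewrite avgE -mulr_sumr mulrA -invfM -expr2. Qed.

Lemma avg2D f g : avg2 (fun n m => f n m + g n m) = avg2 f + avg2 g.
Proof.
rewrite !avg2_avg -avgD; congr avg; apply/funext => n; exact: avgD.
Qed.

Lemma avg2Z (k : R) f : avg2 (fun n m => k * f n m) = k * avg2 f.
Proof.
rewrite !avg2_avg -avgZ; congr avg; apply/funext => n; exact: avgZ.
Qed.

Lemma avg2_sum (I : finType) (f : I -> 'I_N -> 'I_N -> R) :
  avg2 (fun n m => \sum_i f i n m) = \sum_i avg2 (f i).
Proof.
rewrite avg2_avg; under eq_fun do rewrite avg_sum.
by rewrite avg_sum; apply: eq_bigr => i _; rewrite avg2_avg.
Qed.

Lemma avg2_ge0 f : (forall n m, 0 <= f n m) -> 0 <= avg2 f.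
Proof. by move=> f0; rewrite avg2_avg; do 2 (apply: avg_ge0 => ?). Qed.

Lemma le_avg2 f g : (forall n m, f n m <= g n m) -> avg2 f <= avg2 g.
Proof.
move=> fg; rewrite /avg2; apply: ler_wpM2l; first by rewrite invr_ge0 sqr_ge0.
by apply: ler_sum => n _; apply: ler_sum => m _.
Qed.

Lemma eq_avg2 f g : (forall n m, f n m = g n m) -> avg2 f = avg2 g.
Proof. by move=> fg; congr avg2; apply/funext => n; apply/funext => m. Qed.

Lemma avg2_zero f : (forall n m, f n m = 0) -> avg2 f = 0.
Proof.
move=> f0; rewrite /avg2 big1 ?scaler0// => n _.
by rewrite big1.
Qed.

Lemma avg2_eq0 f : (0 < N)%N -> (forall n m, 0 <= f n m) -> avg2 f = 0 ->
  forall n m, f n m = 0.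
Proof.
move=> N0 f0 /eqP; rewrite /avg2 scaler_eq0 invr_eq0 expf_eq0/= pnatr_eq0.
rewrite -leqn0 leqNgt N0/= => /eqP sum0 n m.
have row0 : \sum_m f n m = 0.
  by apply: (psumr_eq0P _ sum0) => // i _; apply: sumr_ge0.
exact: (psumr_eq0P _ row0).
Qed.

(** Independence of the two particles: a product of one-body quantities averages
    to the product of the averages. The list form expands a polynomial in both
    particles at once. *)
Lemma avg2_prod (s : seq (('I_N -> R) * ('I_N -> R))) :
  avg2 (fun n m => \sum_(t <- s) t.1 n * t.2 m) = \sum_(t <- s) avg t.1 * avg t.2.
Proof.
elim: s => [|t s IHs].
  by rewrite big_nil avg2_zero// => n m; rewrite big_nil.
rewrite big_cons -IHs.
rewrite (_ : avg t.1 * avg t.2 = avg2 (fun n m => t.1 n * t.2 m)).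
  by rewrite -avg2D; apply: eq_avg2 => n m; rewrite big_cons.
rewrite avg2_avg; under eq_fun do rewrite avgZ mulrC.
by rewrite avgZ mulrC.
Qed.

Lemma sqr_avgM_le F G :
  avg (fun n => F n * G n) ^+ 2 <= avg (fun n => F n ^+ 2) * avg (fun n => G n ^+ 2).
Proof.
rewrite !avgE [leRHS]mulrACA exprMn -expr2.
apply: ler_wpM2l; first exact: sqr_ge0.
rewrite [leRHS]mulrC.
by apply: sqr_sum_le => n; rewrite ?sqr_ge0// exprMn mulrC.
Qed.

Lemma hoelder_avg2 (f g : 'I_N -> 'I_N -> R) (p q : R) :
  (0 < N)%N -> 0 < p -> 0 < q -> p^-1 + q^-1 = 1 ->
  (forall n m, 0 <= f n m) -> (forall n m, 0 <= g n m) ->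
  avg2 (fun n m => f n m * g n m) <=
  avg2 (fun n m => f n m `^ p) `^ p^-1 * avg2 (fun n m => g n m `^ q) `^ q^-1.
Proof.
move=> N0 p0 q0 pq f0 g0.
set F := avg2 (fun n m => f n m `^ p); set G := avg2 (fun n m => g n m `^ q).
have F0 : 0 <= F by apply: avg2_ge0 => n m; exact: powR_ge0.
have G0 : 0 <= G by apply: avg2_ge0 => n m; exact: powR_ge0.
have null (h : 'I_N -> 'I_N -> R) r : avg2 (fun n m => h n m `^ r) = 0 ->
    forall n m, h n m = 0.
  move=> h0 n m; apply: (@powR_eq0_eq0 _ _ r).
  by apply: (@avg2_eq0 (fun n m => h n m `^ r)) => // *; exact: powR_ge0.
have rhs0 : 0 <= F `^ p^-1 * G `^ q^-1 by rewrite mulr_ge0 ?powR_ge0.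
have zero : (forall n m, f n m * g n m = 0) ->
    avg2 (fun n m => f n m * g n m) <= F `^ p^-1 * G `^ q^-1.
  by move=> fg0; rewrite avg2_zero.
(* When one of the norms vanishes, so does the product being averaged, and the
   normalization is not available. *)
have [F00|F00] := eqVneq F 0.
  by apply: zero => n m; rewrite (null _ _ F00) mul0r.
have [G00|G00] := eqVneq G 0.
  by apply: zero => n m; rewrite (null _ _ G00) mulr0.
have Fp : 0 < F by rewrite lt_def F00.
have Gp : 0 < G by rewrite lt_def G00.
have young n m := young_normalized _ _ _ _ _ _ _ p0 q0 pq (f0 n m) (g0 n m) Fp Gp.
apply: (le_trans (le_avg2 _ _ young)).
rewrite avg2Z avg2D !avg2Z -/F -/G.
clearbody F G; have -> : (p * F)^-1 * F + (q * G)^-1 * G = 1; last by rewrite mulr1.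
by rewrite -pq; field; rewrite F00 G00 !gt_eqF.
Qed.

End Averages.

(** The Hoelder inequality twice: with exponents 1 / theta and 1 / (1 - theta)
    to separate f g from A, then with p1 and p2 to separate f from g. *)
Lemma hoelder_moments (R : realType) (N : nat) (f g A : 'I_N -> 'I_N -> R)
    (s theta p1 p2 : R) :
  (0 < N)%N -> 0 < s -> 0 < theta -> theta < 1 -> 0 < p1 -> 0 < p2 ->
  p1^-1 + p2^-1 = 1 ->
  (forall n m, 0 <= f n m) -> (forall n m, 0 <= g n m) ->
  (forall n m, 0 <= A n m) ->
  avg2 (fun n m => (f n m * g n m) `^ (s * theta) * A n m `^ (1 - theta)) <=
  (avg2 (fun n m => f n m `^ (p1 * s)) `^ (p1 * s)^-1) `^ (s * theta) *
  (avg2 (fun n m => g n m `^ (p2 * s)) `^ (p2 * s)^-1) `^ (s * theta) *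
  avg2 A `^ (1 - theta).
Proof.
move=> N0 s0 t0 t1 p1_gt0 p2_gt0 p12 f0 g0 A0.
have tt0 : 0 < 1 - theta by rewrite subr_gt0.
have moment_root (h : 'I_N -> 'I_N -> R) (p : R) : 0 < p ->
    (avg2 (fun n m => h n m `^ (p * s)) `^ (p * s)^-1) `^ (s * theta) =
    (avg2 (fun n m => (h n m `^ s) `^ p) `^ p^-1) `^ theta.
  move=> p_gt0.
  rewrite (@eq_avg2 R N _ (fun n m => (h n m `^ s) `^ p)); last first.
    by move=> n m; rewrite -powRrM mulrC.
  rewrite -!powRrM; congr (_ `^ _).
  by field; rewrite !gt_eqF.
apply: (@le_trans _ _ (avg2 (fun n m => f n m `^ s * g n m `^ s) `^ theta *
    avg2 A `^ (1 - theta))).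
  apply: le_trans (hoelder_avg2 _ _ _ _ theta^-1 (1 - theta)^-1 N0 _ _ _ _ _) _.
  - by rewrite invr_gt0.
  - by rewrite invr_gt0.
  - by rewrite !invrK addrC subrK.
  - by move=> n m; exact: powR_ge0.
  - by move=> n m; exact: powR_ge0.
  rewrite !invrK le_eqVlt; apply/orP; left; apply/eqP; congr (_ `^ _ * _ `^ _).
    apply: eq_avg2 => n m; rewrite -powRrM mulfK ?gt_eqF//.
    exact: powRM.
  apply: eq_avg2 => n m; rewrite -powRrM mulfV ?gt_eqF//.
  exact: powRr1.
apply: ler_wpM2r; first exact: powR_ge0.
rewrite [leRHS](congr2 *%R (moment_root f p1 p1_gt0) (moment_root g p2 p2_gt0)).
rewrite -(powRM theta (powR_ge0 _ p1^-1) (powR_ge0 _ p2^-1)).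
apply: ge0_ler_powR; first exact: ltW.
- by apply: avg2_ge0 => n m; exact: mulr_ge0 (powR_ge0 _ _) (powR_ge0 _ _).
- exact: mulr_ge0 (powR_ge0 _ _) (powR_ge0 _ _).
by apply: hoelder_avg2 => // n m; exact: powR_ge0.
Qed.

(** * The pointwise bound with its sharp constant *)

Lemma bernoulli_powR (R : realType) (x b : R) :
  0 <= x -> 0 < b -> b < 1 -> x `^ b <= b * x + (1 - b).
Proof.
move=> x0 b0 b1.
have b1' : 0 < 1 - b by rewrite subr_gt0.
have := @conjugate_powR R (x `^ b) 1 b^-1 (1 - b)^-1.
rewrite powR_ge0 ler01 !invr_gt0 !invrK => /(_ isT isT b0 b1').
rewrite -powRrM mulfV ?gt_eqF// powRr1// powR1 mulr1 mul1r mulrC; apply; lra.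
Qed.

(** By homogeneity put A = r t with 0 <= t <= 2; then k_ alpha is the maximum of
    t^(1 / (1 + alpha)) (2 - t), attained at tau = 2 / (2 + alpha). Writing
    t = tau x and bounding the power of x by Bernoulli's inequality reduces this
    to (x + alpha) (2 + alpha - x) <= (1 + alpha)^2, two factors of fixed sum. *)
Lemma deficit_le (R : realType) (alpha r A : R) :
  0 < alpha -> 0 <= r -> 0 <= A -> A <= 2 * r ->
  A * (2 * r - A) <= k_ alpha *
    (r `^ ((2 + alpha) / (1 + alpha)) * A `^ (alpha / (1 + alpha))).
Proof.
move=> al0 r0 A0 Ar.
have a1 : 1 + alpha != 0 by rewrite gt_eqF//; lra.
have a2 : 2 + alpha != 0 by rewrite gt_eqF//; lra.
have [Ae0|Ane0] := eqVneq A 0.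
  rewrite Ae0 mul0r mulr_ge0 ?mulr_ge0 ?powR_ge0//; lra.
have Ap : 0 < A by rewrite lt_def Ane0.
have rp : 0 < r by lra.
pose b := (1 + alpha)^-1.
have b0 : 0 < b by rewrite invr_gt0; lra.
have b1 : b < 1 by rewrite invf_lt1; lra.
pose tau := 2 / (2 + alpha).
have tau0 : 0 < tau by rewrite divr_gt0//; lra.
pose x := A / r / tau.
have x0 : 0 < x by apply: divr_gt0 => //; exact: divr_gt0.
have Ax : A = tau * x * r by rewrite /x; field; rewrite !gt_eqF.
have e1 : (2 + alpha) / (1 + alpha) = 1 + b by rewrite /b; field.
have e2 : alpha / (1 + alpha) = 1 - b by rewrite /b; field.
rewrite /k_ -/tau e1 e2.
have t2 : x `^ b * (2 + alpha - x) <= 1 + alpha.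
  have xb := @bernoulli_powR R x b (ltW x0) b0 b1.
  have x2 : x <= 2 + alpha.
    rewrite /x ler_pdivrMr// ler_pdivrMr// /tau mulrCA mulfV// mulr1 //.
  apply: (@le_trans _ _ ((b * x + (1 - b)) * (2 + alpha - x))).
    by apply: ler_wpM2r => //; rewrite subr_ge0.
  rewrite -(@ler_pM2l _ (1 + alpha)); last lra.
  rewrite mulrA [(1 + alpha) * (_ + _)](_ : _ = x + alpha); last by rewrite /b; field.
  have := sqr_ge0 (x - 1); nra.
have D (s t : R) : 0 < s -> s `^ (1 + t) = s * s `^ t.
  by move=> s0; rewrite powRD ?(gt_eqF s0) ?implybT// powRr1// ltW.
have Dn (s t : R) : 0 < s -> s `^ (1 - t) = s / s `^ t.
  by move=> s0; rewrite D// powRN.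
rewrite D// D// Dn//.
have Ab : A `^ b = tau `^ b * x `^ b * r `^ b.
  have tx0 : 0 <= tau * x by apply: mulr_ge0; exact: ltW.
  by rewrite {1}Ax (@powRM R _ _ _ tx0 (ltW rp)) (@powRM R _ _ _ (ltW tau0) (ltW x0)).
rewrite Ab.
have tb := powR_gt0 b tau0; have xb := powR_gt0 b x0; have rb := powR_gt0 b rp.
rewrite [leRHS](_ : _ = A * (r * tau * ((1 + alpha) / x `^ b))); last first.
  by field; rewrite !gt_eqF.
rewrite ler_pM2l// [leLHS](_ : _ = r * tau * (2 + alpha - x)); last first.
  by rewrite Ax /tau; field.
by rewrite (ler_pM2l (mulr_gt0 rp tau0)) ler_pdivlMr// mulrC.
Qed.

(** * The two-body average of squared minors *)

(** Put w = a q - b p and z n m = a n q m + a m q n - b n p m - b m p n. The minor is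
    w n + w m - z n m, and the product of w n + w m with z n m averages to 0
    because every monomial of it has a centred one-body factor. Hence the
    average is at least that of z ^+ 2, which is explicit; the vanishing
    correlation of a and b removes its only other term of indefinite sign. *)
Lemma two_body_minor_ge (R : realType) (N : nat) (a b p q : 'I_N -> R) :
  avg a = 0 -> avg b = 0 -> avg p = 0 -> avg q = 0 ->
  avg (fun n => a n * b n) = 0 ->
  2 * (avg (fun n => a n ^+ 2) * avg (fun n => q n ^+ 2) +
       avg (fun n => p n ^+ 2) * avg (fun n => b n ^+ 2) -
       2 * (avg (fun n => a n * p n) * avg (fun n => b n * q n))) <=
  avg2 (fun n m => ((a n - a m) * (q n - q m) - (b n - b m) * (p n - p m)) ^+ 2).
Proof.
move=> a0 b0 p0 q0 ab0.
pose w n := a n * q n - b n * p n.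
pose z n m := a n * q m + a m * q n - b n * p m - b m * p n.
rewrite (@eq_avg2 _ _ _ (fun n m => (z n m ^+ 2 + (w n + w m) ^+ 2) +
    (-2) * ((w n + w m) * z n m))); last first.
  by move=> n m; rewrite /w /z; ring.
rewrite avg2D avg2D avg2Z.
have -> : avg2 (fun n m => (w n + w m) * z n m) = 0.
  pose neg (f : 'I_N -> R) n := -1 * f n.
  rewrite (@eq_avg2 _ _ _ (fun n m => \sum_(t <-
    [:: (fun n => w n * a n, q); (fun n => w n * q n, a);
        (neg (fun n => w n * b n), p); (neg (fun n => w n * p n), b);
        (a, fun n => w n * q n); (q, fun n => w n * a n);
        (b, neg (fun n => w n * p n)); (p, neg (fun n => w n * b n))])
      t.1 n * t.2 m)).
    rewrite avg2_prod !big_cons big_nil /= a0 b0 p0 q0.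
    by rewrite !mulr0 !mul0r !addr0.
  by move=> n m; rewrite !big_cons big_nil /z /neg /=; ring.
have w0 : 0 <= avg2 (fun n m => (w n + w m) ^+ 2).
  by apply: avg2_ge0 => n m; exact: sqr_ge0.
rewrite mulr0 addr0.
suff -> : avg2 (fun n m => z n m ^+ 2) =
    2 * (avg (fun n => a n ^+ 2) * avg (fun n => q n ^+ 2) +
       avg (fun n => p n ^+ 2) * avg (fun n => b n ^+ 2) -
       2 * (avg (fun n => a n * p n) * avg (fun n => b n * q n))) +
    2 * (avg (fun n => a n * q n) ^+ 2 + avg (fun n => b n * p n) ^+ 2).
  have := sqr_ge0 (avg (fun n => a n * q n)).
  have := sqr_ge0 (avg (fun n => b n * p n)).
  move: w0; lra.
pose scale (k : R) (f : 'I_N -> R) n := k * f n.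
have scaleE k f : avg (scale k f) = k * avg f by exact: avgZ.
rewrite (@eq_avg2 _ _ _ (fun n m => \sum_(t <-
    [:: (fun n => a n ^+ 2, fun n => q n ^+ 2);
        (fun n => q n ^+ 2, fun n => a n ^+ 2);
        (fun n => b n ^+ 2, fun n => p n ^+ 2);
        (fun n => p n ^+ 2, fun n => b n ^+ 2);
        (scale 2 (fun n => a n * q n), fun n => a n * q n);
        (scale 2 (fun n => b n * p n), fun n => b n * p n);
        (scale (-2) (fun n => a n * b n), fun n => p n * q n);
        (scale (-2) (fun n => p n * q n), fun n => a n * b n);
        (scale (-2) (fun n => a n * p n), fun n => b n * q n);
        (scale (-2) (fun n => b n * q n), fun n => a n * p n)])
      t.1 n * t.2 m)).
  by rewrite avg2_prod !big_cons big_nil /= !scaleE ab0; ring.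
by move=> n m; rewrite !big_cons big_nil /z /scale /=; ring.
Qed.

Section DotProduct.
Variables (R : realType) (d : nat).
Implicit Types x y : 'cV[R]_d.

Lemma dotpE x y : dotp x y = (x^T *m y) 0 0.
Proof. by rewrite mxE; apply: eq_bigr => i _; rewrite mxE. Qed.

Lemma dotpC x y : dotp x y = dotp y x.
Proof. by apply: eq_bigr => i _; rewrite mulrC. Qed.

Lemma dotp_ge0 x : 0 <= dotp x x.
Proof. by apply: sumr_ge0 => i _; rewrite -expr2 sqr_ge0. Qed.

Lemma enorm_sqr x : enorm x ^+ 2 = dotp x x.
Proof. by rewrite sqr_sqrtr// dotp_ge0. Qed.

Lemma dotp_sqr_le x y : dotp x y ^+ 2 <= dotp x x * dotp y y.
Proof.
apply: sqr_sum_le => i; rewrite -?expr2 ?sqr_ge0//.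
by rewrite exprMn.
Qed.

Lemma dotp_le_enorm x y : `|dotp x y| <= enorm x * enorm y.
Proof.
rewrite -ler_sqr ?nnegrE ?mulr_ge0 ?sqrtr_ge0//.
by rewrite real_normK ?num_real// exprMn !enorm_sqr dotp_sqr_le.
Qed.

Lemma dotp_orthogonal (E : 'M[R]_d) x y :
  E^T *m E = 1%:M -> dotp (E *m x) (E *m y) = dotp x y.
Proof. by move=> EE; rewrite !dotpE trmx_mul mulmxA -(mulmxA _ E^T) EE mulmx1. Qed.

Lemma lagrange_identity x y :
  2 * (dotp x x * dotp y y - dotp x y ^+ 2) =
  \sum_i \sum_j (x i 0 * y j 0 - x j 0 * y i 0) ^+ 2.
Proof.
have prod (f g : 'I_d -> R) :
    (\sum_i f i) * (\sum_j g j) = \sum_i \sum_j f i * g j.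
  by rewrite mulr_suml; apply: eq_bigr => i _; rewrite mulr_sumr.
have -> : 2 * (dotp x x * dotp y y - dotp x y ^+ 2) =
  dotp x x * dotp y y + dotp y y * dotp x x - 2 * (dotp x y * dotp x y) by ring.
rewrite /dotp !prod mulr_sumr -big_split -sumrB; apply: eq_bigr => i _ /=.
rewrite mulr_sumr -big_split -sumrB; apply: eq_bigr => j _ /=; ring.
Qed.

End DotProduct.

(** Lagrange's identity turns the integrand into a sum of squared minors, whose
    averages are bounded below by two_body_minor_ge; the resulting sum over
    pairs of distinct coordinates is the one of weighted_trace_le. *)
Lemma two_body_deficit_ge_diagonal (R : realType) (d N : nat)
    (u v : 'I_N -> 'cV[R]_d) (L : R) :
  avg u = 0 -> avg v = 0 ->
  avg (fun n => dotp (u n) (u n)) = 1 -> avg (fun n => dotp (v n) (v n)) = 1 ->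
  (forall i j, i != j -> avg (fun n => u n i 0 * u n j 0) = 0) ->
  (forall i, avg (fun n => u n i 0 ^+ 2) <= L) ->
  (1 - L) * (1 - avg (fun n => dotp (u n) (v n)) ^+ 2) <=
  avg2 (fun n m => dotp (u n - u m) (u n - u m) * dotp (v n - v m) (v n - v m)
                   - dotp (u n - u m) (v n - v m) ^+ 2).
Proof.
move=> u0 v0 u1 v1 uij uL.
pose a i := avg (fun n => u n i 0 ^+ 2).
pose b i := avg (fun n => v n i 0 ^+ 2).
pose c i := avg (fun n => u n i 0 * v n i 0).
have a0 i : 0 <= a i by apply: avg_ge0 => n; exact: sqr_ge0.
have b0 i : 0 <= b i by apply: avg_ge0 => n; exact: sqr_ge0.
have cE : avg (fun n => dotp (u n) (v n)) = \sum_i c i by exact: avg_sum.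
have a1 : \sum_i a i = 1 by rewrite -u1 /dotp avg_sum.
have b1 : \sum_i b i = 1 by rewrite -v1 /dotp avg_sum.
rewrite cE.
apply: (le_trans (@weighted_trace_le R _ a b c L a0 b0 _ a1 b1 uL)).
  by move=> i; exact: sqr_avgM_le.
rewrite -(@ler_pM2l _ 2)// -avg2Z.
rewrite (eq_avg2 _ _ _ _ (fun n m => lagrange_identity R d (u n - u m) (v n - v m))).
rewrite avg2_sum mulr_sumr; apply: ler_sum => i _.
rewrite avg2_sum [leRHS](bigD1 i)//= mulr_sumr -[leLHS]add0r; apply: lerD.
  by apply: avg2_ge0 => n m; exact: sqr_ge0.
apply: ler_sum => j ij.
have coord0 (w : 'I_N -> 'cV[R]_d) k : avg w = 0 -> avg (fun n => w n k 0) = 0.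
  by move=> w0; rewrite -avg_coord w0 mxE.
have := @two_body_minor_ge R N (fun n => u n i 0) (fun n => u n j 0)
  (fun n => v n i 0) (fun n => v n j 0) (coord0 _ _ u0) (coord0 _ _ u0)
  (coord0 _ _ v0) (coord0 _ _ v0) (uij _ _ _).
rewrite eq_sym => /(_ ij) /le_trans; apply.
by apply: le_avg2 => n m; rewrite !mxE.
Qed.

(** * Reduction to a diagonal second moment matrix *)

Section SecondMomentMatrix.
Variables (R : realType) (d N : nat) (u : 'I_N -> 'cV[R]_d).
Let S := avg (fun n => otimes (u n) (u n)).

Lemma second_momentE (m1 m2 : nat) (A : 'M[R]_(m1, d)) (B : 'M[R]_(m2, d)) i j :
  (A *m S *m B^T) i j = avg (fun n => (A *m u n) i 0 * (B *m u n) j 0).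
Proof.
rewrite /S /avg -scalemxAr -scalemxAl mxE; congr (_ * _).
rewrite mulmx_sumr mulmx_suml summxE; apply: eq_bigr => n _.
rewrite /otimes mulmxA -(mulmxA (A *m _)) -trmx_mul.
by rewrite mxE big_ord1 !mxE.
Qed.

Lemma second_moment_sym : S^T = S.
Proof.
rewrite /S /avg linearZ/= linear_sum/=; congr (_ *: _).
by apply: eq_bigr => n _; rewrite /otimes trmx_mul trmxK.
Qed.

(** For an eigenvector x, a |x|^2 is the average of (x . u)^2, which is at most
    |x|^2 |u|^2. *)
Lemma second_moment_eigenvalue_le1 (a : R) :
  avg (fun n => dotp (u n) (u n)) = 1 -> eigenvalue S a -> a <= 1.
Proof.
move=> u1 /eigenvalueP[x xS x0].
have xx : (x *m x^T) 0 0 = dotp x^T x^T by rewrite dotpE trmxK.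
have xx_gt0 : 0 < dotp x^T x^T by rewrite -xx row_sqr_gt0.
rewrite -(@ler_pM2r _ (dotp x^T x^T))// mul1r.
have -> : a * dotp x^T x^T = avg (fun n => (x *m u n) 0 0 ^+ 2).
  rewrite -xx -second_momentE xS -scalemxAl [RHS]mxE//.
rewrite -[leRHS]mulr1 -u1 -avgZ !avgE.
apply: ler_wpM2l; first by rewrite invr_ge0.
apply: ler_sum => n _.
by rewrite -{1}[x]trmxK -dotpE dotp_sqr_le.
Qed.

Lemma eigenvalue_le_max (a : R) :
  avg (fun n => dotp (u n) (u n)) = 1 ->
  eigenvalue S a -> a <= max_eigenvalue S.
Proof.
move=> u1 Sa; apply: ub_le_sup => //.
by exists 1 => b; exact: second_moment_eigenvalue_le1.
Qed.

(** In the coordinates given by the eigenbasis E, distinct components of u are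
    uncorrelated and the variances are eigenvalues of S. *)
Lemma second_moment_diagonalization :
  exists2 E : 'M[R]_d, E^T *m E = 1%:M &
  (forall i j, i != j -> avg (fun n => (E *m u n) i 0 * (E *m u n) j 0) = 0) /\
  (forall i, eigenvalue S (avg (fun n => (E *m u n) i 0 ^+ 2))).
Proof.
have [E [D [EE ES]]] := @orthonormal_eigenfamily R d S d second_moment_sym (leqnn d).
have ESE : E *m S *m E^T = diag_mx D by rewrite ES -mulmxA EE mulmx1.
exists E; first exact: mulmx1C.
split=> [i j ij|i].
  by rewrite -second_momentE ESE mxE (negPf ij).
have -> : avg (fun n => (E *m u n) i 0 ^+ 2) = D 0 i.
  by rewrite -second_momentE ESE mxE eqxx.
apply/eigenvalueP; exists (row i E).
  by rewrite -row_mul ES row_mul row_diag_mx -scalemxAl -rowE.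
apply/eqP => Ei0; have /matrixP/(_ i i) := EE.
rewrite mxE [RHS]mxE eqxx big1 => [/esym/eqP|j _]; first by rewrite oner_eq0.
by move/rowP/(_ j): Ei0; rewrite !mxE => ->; rewrite mul0r.
Qed.

Lemma max_eigenvalue_le1 :
  avg (fun n => dotp (u n) (u n)) = 1 -> (0 < d)%N -> max_eigenvalue S <= 1.
Proof.
move=> u1 d0; have [E _ [_ eigE]] := second_moment_diagonalization.
apply: ge_sup; first by eexists; exact: (eigE (Ordinal d0)).
by move=> a; exact: second_moment_eigenvalue_le1.
Qed.

End SecondMomentMatrix.

(** Averages of vectors, inner products and hence the two-body average are
    unchanged by the rotation E, in which S becomes diagonal. *)
Lemma two_body_deficit_ge (R : realType) (d N : nat) (u v : 'I_N -> 'cV[R]_d) :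
  avg u = 0 -> avg v = 0 ->
  avg (fun n => dotp (u n) (u n)) = 1 -> avg (fun n => dotp (v n) (v n)) = 1 ->
  (1 - max_eigenvalue (avg (fun n => otimes (u n) (u n)))) *
  (1 - avg (fun n => dotp (u n) (v n)) ^+ 2) <=
  avg2 (fun n m => dotp (u n - u m) (u n - u m) * dotp (v n - v m) (v n - v m)
                   - dotp (u n - u m) (v n - v m) ^+ 2).
Proof.
move=> u0 v0 u1 v1; have [E EE [Eij Ei]] := second_moment_diagonalization _ _ _ u.
have dE x y := @dotp_orthogonal R d E x y EE.
have rot0 (w : 'I_N -> 'cV[R]_d) : avg w = 0 -> avg (fun n => E *m w n) = 0.
  by rewrite /avg -mulmx_sumr scalemxAr => ->; rewrite mulmx0.
have rot_dot (w w' : 'I_N -> 'cV[R]_d) :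
    avg (fun n => dotp (E *m w n) (E *m w' n)) = avg (fun n => dotp (w n) (w' n)).
  by congr avg; apply/funext => n; exact: dE.
have /= := @two_body_deficit_ge_diagonal R d N (fun n => E *m u n) (fun n => E *m v n)
  (max_eigenvalue (avg (fun n => otimes (u n) (u n)))) (rot0 _ u0) (rot0 _ v0).
rewrite !rot_dot u1 v1 => /(_ erefl erefl Eij).
move=> /(_ (fun i => eigenvalue_le_max R d N u _ u1 (Ei i)))/le_trans; apply.
by apply: le_avg2 => n m; rewrite -!mulmxBr !dE.
Qed.

(** * The inequality between the two averages *)

Lemma kappa_two_body_deficit_ge (R : realType) (d N : nat) (u v : 'I_N -> 'cV[R]_d) :
  (0 < d)%N -> avg u = 0 -> avg v = 0 ->
  avg (fun n => dotp (u n) (u n)) = 1 -> avg (fun n => dotp (v n) (v n)) = 1 ->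
  kappa (avg (fun n => otimes (u n) (u n))) = +oo%E \/
  exists K : R, [/\ 0 <= K, kappa (avg (fun n => otimes (u n) (u n))) = K%:E &
  1 - avg (fun n => dotp (u n) (v n)) ^+ 2 <= K *
  avg2 (fun n m => dotp (u n - u m) (u n - u m) * dotp (v n - v m) (v n - v m)
                   - dotp (u n - u m) (v n - v m) ^+ 2)].
Proof.
move=> d0 u0 v0 u1 v1; rewrite /kappa.
have L1 := max_eigenvalue_le1 _ _ _ _ u1 d0.
have := @two_body_deficit_ge R d N u v u0 v0 u1 v1.
case: eqVneq => [|Lne] H; [by left|right].
have Lpos : 0 < 1 - max_eigenvalue (avg (fun n => otimes (u n) (u n))).
  by rewrite subr_gt0 lt_def eq_sym Lne.
exists (1 - max_eigenvalue (avg (fun n => otimes (u n) (u n))))^-1; split => //.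
  by rewrite invr_ge0 ltW.
by rewrite mulrC ler_pdivlMr// mulrC.
Qed.

(** With r = |u - u'| |v - v'| and A = r - (u - u') . (v - v'), the integrand is
    A (2 r - A), to which the pointwise bound and the Hoelder inequalities
    apply with theta = 1 / (1 + alpha). *)
Lemma two_body_deficit_le (R : realType) (d N : nat) (u v : 'I_N -> 'cV[R]_d)
    (alpha p1 p2 : R) :
  (0 < N)%N -> 0 < alpha -> 1 < p1 -> 1 < p2 -> p1^-1 + p2^-1 = 1 ->
  avg2 (fun n m => dotp (u n - u m) (u n - u m) * dotp (v n - v m) (v n - v m)
                   - dotp (u n - u m) (v n - v m) ^+ 2) <=
  k_ alpha *
    (moment u (p1 * (2 + alpha)) `^ ((2 + alpha) / (1 + alpha)) *
     moment v (p2 * (2 + alpha)) `^ ((2 + alpha) / (1 + alpha)) *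
     (avg2 (fun n m => enorm (u n - u m) * enorm (v n - v m)
                       - dotp (u n - u m) (v n - v m)))
       `^ (alpha / (1 + alpha))).
Proof.
move=> N0 al0 p10 p20 p12.
have a1 : 0 < 1 + alpha by lra.
have -> : alpha / (1 + alpha) = 1 - (1 + alpha)^-1 by field; rewrite gt_eqF.
pose r n m := enorm (u n - u m) * enorm (v n - v m).
pose A n m := r n m - dotp (u n - u m) (v n - v m).
have r0 n m : 0 <= r n m by rewrite mulr_ge0 ?sqrtr_ge0.
have Abound n m : 0 <= A n m /\ A n m <= 2 * r n m.
  have := dotp_le_enorm _ _ (u n - u m) (v n - v m).
  by rewrite /A -/(r n m) ler_norml => /andP[]; split; lra.
have k0 : 0 <= k_ alpha by rewrite mulr_ge0 ?powR_ge0// ltW.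
apply: (@le_trans _ _ (avg2 (fun n m => k_ alpha *
    (r n m `^ ((2 + alpha) / (1 + alpha)) * A n m `^ (1 - (1 + alpha)^-1))))).
  apply: le_avg2 => n m; have [A0 Ar] := Abound n m.
  have -> : 1 - (1 + alpha)^-1 = alpha / (1 + alpha) by field; rewrite gt_eqF.
  apply: le_trans (deficit_le _ _ _ _ al0 (r0 n m) A0 Ar).
  by rewrite -!enorm_sqr /A /r le_eqVlt; apply/orP; left; apply/eqP; ring.
rewrite avg2Z; apply: ler_wpM2l => //.
apply: hoelder_moments => // [|||||n m|n m|n m].
- by lra.
- by rewrite invr_gt0.
- by rewrite invf_lt1//; lra.
- by lra.
- by lra.
- exact: sqrtr_ge0.
- exact: sqrtr_ge0.
- by have [] := Abound n m.
Qed.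

(* The test on kmin implements the convention that the right-hand side is +oo
   as soon as both condition numbers are; in \bar R one has +oo * 0 = 0. *)
Theorem proposition2p7 (R : realType) (d N : nat) (hd : (2 <= d)%N)
    (hN : (1 <= N)%N) (u v : 'I_N -> 'cV[R]_d)
    (hu0 : avg u = 0) (hv0 : avg v = 0)
    (hu1 : avg (fun n => enorm (u n) ^+ 2) = 1)
    (hv1 : avg (fun n => enorm (v n) ^+ 2) = 1)
    (alpha p1 p2 : R) (halpha : 0 < alpha) (hp1 : 1 < p1) (hp2 : 1 < p2)
    (hp : p1^-1 + p2^-1 = 1) :
  let kmin := Order.min (kappa (avg (fun n => otimes (u n) (u n))))
                        (kappa (avg (fun n => otimes (v n) (v n)))) in
  ((f4 (avg (fun n => enorm (u n - v n) ^+ 2)))%:E <=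
    if kmin == +oo then +oo else
    (k_ alpha)%:E * kmin *
    (moment u (p1 * (2 + alpha)) `^ ((2 + alpha) / (1 + alpha)) *
     moment v (p2 * (2 + alpha)) `^ ((2 + alpha) / (1 + alpha)) *
     (avg2 (fun n m => enorm (u n - u m) * enorm (v n - v m)
                       - dotp (u n - u m) (v n - v m)))
       `^ (alpha / (1 + alpha)))%:E)%E.
Proof.
cbv zeta; set kmin := Order.min _ _.
have u1 : avg (fun n => dotp (u n) (u n)) = 1.
  by rewrite -hu1; congr avg; apply/funext => n; rewrite enorm_sqr.
have v1 : avg (fun n => dotp (v n) (v n)) = 1.
  by rewrite -hv1; congr avg; apply/funext => n; rewrite enorm_sqr.
have d0 : (0 < d)%N by exact: ltn_trans hd.
have -> : f4 (avg (fun n => enorm (u n - v n) ^+ 2)) =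
    1 - avg (fun n => dotp (u n) (v n)) ^+ 2.
  have -> : avg (fun n => enorm (u n - v n) ^+ 2) =
      avg (fun n => dotp (u n) (u n)) + avg (fun n => dotp (v n) (v n)) -
      2 * avg (fun n => dotp (u n) (v n)).
    rewrite -avgD -avgZ -avgB; congr avg; apply/funext => n.
    rewrite enorm_sqr /dotp mulr_sumr -big_split -sumrB.
    by apply: eq_bigr => i _; rewrite !mxE/=; ring.
  by rewrite u1 v1 /f4; field.
have [kminy|kminNy] := eqVneq kmin +oo%E; first exact: leey.
(* The deficit is symmetric in u and v, so that either condition number serves. *)
have key : exists K : R, [/\ 0 <= K, kmin = K%:E &
  1 - avg (fun n => dotp (u n) (v n)) ^+ 2 <= K *
  avg2 (fun n m => dotp (u n - u m) (u n - u m) * dotp (v n - v m) (v n - v m)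
                   - dotp (u n - u m) (v n - v m) ^+ 2)].
  move: kminNy; rewrite /kmin minEle; case: ifP => _ kNy.
    by case: (kappa_two_body_deficit_ge _ _ _ _ _ d0 hu0 hv0 u1 v1) => // kE;
      rewrite kE eqxx in kNy.
  case: (kappa_two_body_deficit_ge _ _ _ _ _ d0 hv0 hu0 v1 u1) => [kE|[K [K0 KE KT]]].
    by rewrite kE eqxx in kNy.
  exists K; split => //.
  have -> : avg (fun n => dotp (u n) (v n)) = avg (fun n => dotp (v n) (u n)).
    by congr avg; apply/funext => n; rewrite dotpC.
  apply: (le_trans KT); apply: ler_wpM2l => //; apply: le_avg2 => n m.
  by rewrite mulrC (dotpC _ _ (v n - v m)).
have [K [K0 -> KT]] := key.
rewrite -!EFinM lee_fin; apply: (le_trans KT).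
rewrite [k_ alpha * K]mulrC -(mulrA K (k_ alpha)).
by apply: ler_wpM2l => //; exact: two_body_deficit_le.
Qed.
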